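(* The semigroup $Q$ given by the semigroup presentation $$Q = \langle a,b,c,e,x \mid xb = cx,\ ac = ca,\ ae=ea,\ ec=ce,\ xca = xe,\ aex = ax\rangle$$ is LEF (locally embeddable into the class of finite semigroups).
   Context: Maps are written on the right. A semigroup $S$ is called LEF if for every finite subset $H$ of $S$ there exist a finite semigroup $F_H$ and an injective function $f_H: H \to F_H$ such that for all $x,y \in H$ with $xy \in H$ we have $(xy)f_H = (xf_H)(yf_H)$. The presentation is a semigroup presentation: $Q$ is the quotient of the free semigroup (nonempty words) on the generators by the congruence generated by the relations; the generator $e$ is not assumed to be idempotent or an identity. *)

(* Defs.v *)
From HB Require Import structures.
From mathcomp Require Import all_boot finmap.
From mathcomp Require Import boolp classical_sets cardinality.

Set Implicit Arguments.
Unset Strict Implicit.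
Unset Printing Implicit Defensive.

Local Open Scope group_scope.
Local Open Scope quotient_scope.

Section FreeSemigroup.
Variable X : choiceType.

Record word := Word { letters :> seq X; letters_neq0 : letters != [::] }.

HB.instance Definition _ := [isSub for letters].
HB.instance Definition _ := [Choice of word by <:].

Lemma cat_word_subproof (u v : word) : letters u ++ letters v != [::].
Proof. by case: u => -[|x u]. Qed.

Definition cat_word (u v : word) : word := Word (cat_word_subproof u v).

Lemma cat_wordA : associative cat_word.
Proof. by move=> u v w; apply/val_inj; rewrite /= catA. Qed.

HB.instance Definition _ := isSemigroup.Build word cat_wordA.

Definition letter (x : X) : word := @Word [:: x] isT.

End FreeSemigroup.

(* The congruence on [S] generated by the pairs listed in [R]. *)
Inductive congruence_closure (S : semigroupType) (R : seq (S * S)) :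
    S -> S -> Prop :=
  | CongrRel u v : (u, v) \in R -> congruence_closure R u v
  | CongrRefl u : congruence_closure R u u
  | CongrSym u v : congruence_closure R u v -> congruence_closure R v u
  | CongrTrans u v w : congruence_closure R u v -> congruence_closure R v w ->
      congruence_closure R u w
  | CongrMul u u' v v' : congruence_closure R u u' ->
      congruence_closure R v v' -> congruence_closure R (u * v) (u' * v').

Section Presentation.
Variables (X : choiceType) (R : seq (word X * word X)).

Definition congrb (u v : word X) : bool := `[< congruence_closure R u v >].

Lemma congrb_refl : reflexive congrb.
Proof. by move=> u; apply/asboolP/CongrRefl. Qed.

Lemma congrb_sym : symmetric congrb.
Proof. by move=> u v; apply/asboolP/asboolP; apply: CongrSym. Qed.

Lemma congrb_trans : transitive congrb.
Proof.
by move=> v u w /asboolP uv /asboolP vw; apply/asboolP/(CongrTrans uv vw).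
Qed.

Canonical congrb_equiv := EquivRel congrb congrb_refl congrb_sym congrb_trans.

Definition presented := {eq_quot congrb}.

HB.instance Definition _ := Choice.on presented.
HB.instance Definition _ := EqQuotient.on presented.

Lemma presented_eqP (u v : word X) :
  \pi_presented u = \pi_presented v <-> congruence_closure R u v.
Proof.
split; first by move/eqmodP/asboolP.
by move=> uv; apply/eqmodP/asboolP.
Qed.

Definition presented_mul (p q : presented) : presented :=
  \pi_presented (repr p * repr q).

Lemma presented_mulE (u v : word X) :
  presented_mul (\pi_presented u) (\pi_presented v) = \pi_presented (u * v).
Proof. by apply/presented_eqP/CongrMul; apply/presented_eqP; rewrite reprK. Qed.

Lemma presented_mulA : associative presented_mul.
Proof.
elim/quotW=> u; elim/quotW=> v; elim/quotW=> w.
rewrite (presented_mulE v w) (presented_mulE u v).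
by rewrite (presented_mulE u (v * w)) (presented_mulE (u * v) w) mulgA.
Qed.

HB.instance Definition _ := isSemigroup.Build presented presented_mulA.

Lemma pi_presentedM (u v : word X) :
  \pi_presented u * \pi_presented v = \pi_presented (u * v).
Proof. exact: presented_mulE. Qed.

End Presentation.

(* [z = x * y] with [z : H] expresses that the product [x * y] lies in [H]. *)
Definition LEF (S : semigroupType) : Prop :=
  forall H : {fset S},
    exists F : semigroupType, finite_set [set: F] /\
    exists f : H -> F, injective f /\
      forall x y z : H, val z = val x * val y -> f z = f x * f y.

Inductive generator := gen_a | gen_b | gen_c | gen_e | gen_x.

Definition nat_of_generator (g : generator) : nat :=
  match g with
  | gen_a => 0 | gen_b => 1 | gen_c => 2 | gen_e => 3 | gen_x => 4
  end.

Definition generator_of_nat (n : nat) : generator :=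
  match n with
  | 0 => gen_a | 1 => gen_b | 2 => gen_c | 3 => gen_e | _ => gen_x
  end.

Lemma nat_of_generatorK : cancel nat_of_generator generator_of_nat.
Proof. by case. Qed.

HB.instance Definition _ := Choice.copy generator (can_type nat_of_generatorK).

Definition Q_relations : seq (word generator * word generator) :=
  let a := letter gen_a in let b := letter gen_b in let c := letter gen_c in
  let e := letter gen_e in let x := letter gen_x in
  [:: (x * b, c * x); (a * c, c * a); (a * e, e * a); (e * c, c * e);
      (x * c * a, x * e); (a * e * x, a * x)].

Definition Q : semigroupType := presented Q_relations.

(* Main.v *)
(* For i > 0 the factor x a^i c^j e^k x of a word depends only on j - i in Z,
   since after x the letter e equals ca and between a and x it disappears; and
   b can be moved through an x on its left, where it becomes c. So an element
   of Q amounts to a list of monomials in a, c, e separated by x or b, where a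
   monomial between two x's that involves a or e counts only through j - i.
   Right multiplication on this data still makes sense when the exponents are
   reduced modulo p (remembering whether they vanish) and lists longer than n
   are sent to a sink. This gives finite right actions of Q, which separate the
   words of length at most n as soon as p > 2n. *)

From HB Require Import structures.
From mathcomp Require Import all_boot finmap.
From mathcomp Require Import ssralg finalg zmodp.
From mathcomp Require Import boolp classical_sets cardinality.
From mathcomp Require Import zify.
Require Import Defs.

Set Implicit Arguments.
Unset Strict Implicit.
Unset Printing Implicit Defensive.

Local Open Scope quotient_scope.

(** * LEF from finite right actions *)

Section Transformations.
Variable Y : finType.

Definition transformation := {ffun Y -> Y}.

HB.instance Definition _ := Finite.on transformation.

Definition transformation_mul (f g : transformation) : transformation :=
  [ffun y => g (f y)].

Lemma transformation_mulA : associative transformation_mul.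
Proof. by move=> f g h; apply/ffunP=> y; rewrite !ffunE. Qed.

HB.instance Definition _ :=
  isSemigroup.Build transformation transformation_mulA.

End Transformations.

(** An element is sent to the transformation induced by its chosen representative; products are
    respected because the action satisfies [R]. As [H] is finite, some [n] bounds the lengths of
    these representatives, and evaluating at [y0] gives injectivity on [H]. *)
Lemma LEF_of_finite_actions (X : choiceType) (R : seq (word X * word X)) :
  (forall n, exists (Y : finType) (act : Y -> X -> Y) (y0 : Y),
     (forall u v y, (u, v) \in R -> foldl act y u = foldl act y v) /\
     (forall u v : word X, size u <= n -> size v <= n ->
        foldl act y0 u = foldl act y0 v -> congruence_closure R u v)) ->
  LEF (presented R).
Proof.
move=> sepR H; pose n := \max_(h : H) size (repr (val h)).
have [Y [act [y0 [actR act_sep]]]] := sepR n.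
have act_congr u v y :
    congruence_closure R u v -> foldl act y u = foldl act y v.
  move=> uv; elim: uv y => {u v} [u v Ruv y||||]; first exact: actR.
  - by [].
  - by move=> u v _ IH y; rewrite IH.
  - by move=> u v w _ IHu _ IHv y; rewrite IHu.
  - by move=> u u' v v' _ IHu _ IHv y; rewrite !foldl_cat IHu IHv.
exists (transformation Y); split; first exact: finite_finset.
exists (fun q : H => [ffun y => foldl act y (repr (val q))]); split.
  move=> p q /ffunP/(_ y0); rewrite !ffunE => eq_pq; apply: val_inj.
  rewrite -[val p]reprK -[val q]reprK; apply/presented_eqP.
  apply: act_sep eq_pq; first exact: (leq_bigmax p).
  exact: (leq_bigmax q).
move=> p q r def_r; apply/ffunP=> y; rewrite !ffunE -foldl_cat.
apply: (@act_congr (repr (val r)) (repr (val p) * repr (val q))%g).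
by apply/presented_eqP; rewrite reprK def_r.
Qed.

(** * Parsing words into blocks of monomials *)

(* The exponents of a monomial [a ^ i * c ^ j * e ^ k]. *)
Definition mono : Type := nat * nat * nat.

(* A word is parsed as blocks, each a monomial followed by [x] ([true]) or
   [b] ([false]), listed from right to left, then a trailing monomial. *)
Definition block : Type := bool * mono.
Definition state : Type := seq block * mono.

Definition mono_mul (m n : mono) : mono :=
  let: (i, j, k) := m in let: (i', j', k') := n in (i + i', j + j', k + k').

Definition ends_x (h : seq block) : bool :=
  if h is (true, _) :: _ then true else false.

(** By [xb = cx], a [b] read just after an [x] becomes a [c] in front of that [x]. *)
Definition mulc_last (h : seq block) : seq block :=
  if h is (is_x, m) :: h' then (is_x, mono_mul m (0, 1, 0)) :: h' else [::].

Definition step (s : state) (g : generator) : state :=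
  let: (h, m) := s in
  match g with
  | gen_a => (h, mono_mul m (1, 0, 0)%N)
  | gen_c => (h, mono_mul m (0, 1, 0)%N)
  | gen_e => (h, mono_mul m (0, 0, 1)%N)
  | gen_x => ((true, m) :: h, (0, 0, 0)%N)
  | gen_b =>
    if ends_x h && (m == (0, 0, 0)) then (mulc_last h, (0, 0, 0))
    else ((false, m) :: h, (0, 0, 0))
  end.

Definition mono_weight (m : mono) : nat := let: (i, j, k) := m in i + j + k.

(** Each block counts one extra for its separator, so this is the number of letters read; it bounds
    every exponent and the number of blocks. *)
Definition weight (s : state) : nat :=
  \sum_(it <- s.1) (mono_weight it.2).+1 + mono_weight s.2.

Lemma weight_step s g : weight (step s g) = (weight s).+1.
Proof.
case: s => h [[i j] k]; case: g; rewrite /weight //=; try lia.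
- case: ifP => [/andP[]|_]; last by rewrite big_cons /=; lia.
  case: h => // -[is_x [[i' j'] k']] h _ /eqP[-> -> ->].
  by rewrite !big_cons /=; lia.
- by rewrite big_cons /=; lia.
Qed.

Lemma weight_run s w : weight (foldl step s w) = weight s + size w.
Proof.
by elim: w s => [|g w IH] s /=; rewrite ?addn0 // IH weight_step addSnnS.
Qed.

(** * Evaluating parses in a monoid that satisfies the relations *)

Section Decoding.
Local Open Scope group_scope.
Variables (M : monoidType) (a b c e x : M).
Hypotheses (xb : x * b = c * x) (ac : commute a c) (ae : commute a e).
Hypotheses (ec : commute e c).
Hypotheses (xca : x * c * a = x * e) (aex : a * e * x = a * x).

Definition gen_val (g : generator) : M :=
  match g with
  | gen_a => a | gen_b => b | gen_c => c | gen_e => e | gen_x => x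
  end.

Definition mono_val (m : mono) : M :=
  let: (i, j, k) := m in a ^+ i * c ^+ j * e ^+ k.

Fixpoint blocks_val (h : seq block) : M :=
  if h is (is_x, m) :: h' then
    blocks_val h' * mono_val m * (if is_x then x else b)
  else 1.

Definition state_val (s : state) : M := blocks_val s.1 * mono_val s.2.

Lemma mono_val_mul m n : mono_val (mono_mul m n) = mono_val m * mono_val n.
Proof.
case: m n => [[i j] k] [[i' j'] k'] /=; rewrite !expgnDr !mulgA.
have ca : commute (c ^+ j) (a ^+ i') by apply/commuteX2/commute_sym.
have ea : commute (e ^+ k) (a ^+ i') by apply/commuteX2/commute_sym.
have ec' : commute (e ^+ k) (c ^+ j') by apply/commuteX2.
rewrite -(mulgA _ (e ^+ k) (a ^+ i')) ea mulgA.
rewrite -(mulgA _ (c ^+ j) (a ^+ i')) ca mulgA.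
by rewrite -(mulgA _ (e ^+ k) (c ^+ j')) ec' mulgA.
Qed.

Lemma state_val_step s g : state_val (step s g) = state_val s * gen_val g.
Proof.
case: s => h m; rewrite /state_val; case: g => /=.
- by rewrite mono_val_mul /= !mulg1 mulgA.
- case: ifP => [/andP[]|_]; last by rewrite /= !mulg1.
  case: h => // -[[] m'] h //= _ /eqP ->.
  by rewrite mono_val_mul /= !mulg1 mul1g -!mulgA xb.
- by rewrite mono_val_mul /= mul1g mulg1 mulgA.
- by rewrite mono_val_mul /= !mul1g mulgA.
- by rewrite !mulg1.
Qed.

Lemma state_val_run s w :
  state_val (foldl step s w) = foldl (fun q g => q * gen_val g) (state_val s) w.
Proof. by elim: w s => //= g w IH s; rewrite IH state_val_step. Qed.

(** By [xca = xe], an [e] behind an [x] can be traded for [ca]; since [a], [c], [e] commute, this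
    can be repeated [k] times. *)
Lemma x_mono_val i j k :
  x * mono_val (i, j, k) = x * mono_val (i + k, j + k, 0).
Proof.
have x_pow : x * e ^+ k = x * mono_val (k, k, 0).
  rewrite /= mulg1; elim: k => [|k IH]; first by rewrite !mulg1.
  have ek : commute (a ^+ k * c ^+ k) e.
    by apply/commute_sym/commuteM; apply: commuteX => //; apply: commute_sym.
  rewrite expgSr mulgA IH -mulgA ek mulgA -xca -!mulgA; congr (x * _).
  rewrite (mulgA a) -expgS mulgA (commuteX k.+1 (commute_sym ac)).
  by rewrite -mulgA -expgS.
have -> : (i, j, k) = mono_mul (0, 0, k) (i, j, 0) by rewrite /= addn0.
rewrite mono_val_mul /= !mul1g mulgA x_pow -mulgA.
by rewrite -(mono_val_mul (k, k, 0) (i, j, 0)) /= addnC (addnC k).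
Qed.

(** A single [a] absorbs every [e] before [x] through [aex = ax]; hence the positive exponent
    [i.+1]. *)
Lemma mono_val_x i j k : mono_val (i.+1, j, k) * x = mono_val (i.+1, j, 0) * x.
Proof.
have pow_x : a * e ^+ k * x = a * x.
  elim: k => [|k IH]; first by rewrite mulg1.
  by rewrite expgS mulgA ae -!mulgA (mulgA a) IH mulgA -ae.
have -> : (i.+1, j, k) = mono_mul (i, j, 0) (1, 0, k)%N.
  by rewrite /= addn1 addn0.
have -> : (i.+1, j, 0) = mono_mul (i, j, 0) (1, 0, 0)%N.
  by rewrite /= addn1 addn0.
by rewrite !mono_val_mul /= !mulg1 -!mulgA (mulgA a) pow_x.
Qed.

(** For [i <= i'], insert [e ^+ (i' - i)]: it disappears in front of the right [x], yet behind the
    left [x] it raises the exponents of [a] and [c] by [i' - i]. *)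
Lemma x_mono_val_x i j i' j' : j + i' = j' + i ->
  x * mono_val (i.+1, j, 0) * x = x * mono_val (i'.+1, j', 0) * x.
Proof.
wlog le_i : i j i' j' / i <= i' => [IH|] eq_ij.
  by case: (leqP i i') => [|/ltnW] le_i; [|symmetry]; apply: IH.
have -> : i' = i + (i' - i) by lia.
have -> : j' = j + (i' - i) by lia.
rewrite -addSn -(x_mono_val i.+1 j (i' - i)).
by rewrite -(mulgA x _ x) -[RHS](mulgA x _ x) [in RHS]mono_val_x.
Qed.

End Decoding.

Arguments mono_val : simpl never.

(** * Reducing exponents to a finite ring *)

Section Reduction.
Variable V : finNzRingType.

(* The monomial with [e] rewritten as [c * a] if it follows an [x]. *)
Definition expand_e (ctx : bool) (m : mono) : mono :=
  let: (i, j, k) := m in if ctx then (i + k, j + k, 0) else m.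

(* The first two flags keep zero and positive exponents apart, which the
   values in [V] do not. *)
Definition red_mono (ctx : bool) (m : mono) : bool * bool * V * V * V :=
  let: (i, j, k) := expand_e ctx m in
  (i + j + k == 0, 0 < i, i%:R%R, j%:R%R, k%:R%R).

(** An [a] in a block ending with [x] erases the [e], and if an [x] also precedes the block, only
    [j - i] matters. The inner flag keeps these cases apart from blocks recorded with all
    exponents. *)
Definition red_block (ctx : bool) (it : block) : bool * (bool * V * V * V) :=
  let: (is_x, m) := it in
  let: (i, j, k) := expand_e ctx m in
  (is_x,
   if is_x && (0 < i) then
     if ctx then (true, 0%R, (j%:R - i%:R)%R, 0%R)
     else (true, i%:R%R, j%:R%R, 0%R)
   else (false, i%:R%R, j%:R%R, k%:R%R)).

Fixpoint red_blocks (h : seq block) :=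
  if h is it :: h' then red_block (ends_x h') it :: red_blocks h' else [::].

Definition red_state (s : state) :=
  (red_blocks s.1, red_mono (ends_x s.1) s.2).

Lemma size_red_blocks h : size (red_blocks h) = size h.
Proof. by elim: h => //= it h ->. Qed.

Lemma red_blocks_ends_x h h' :
  red_blocks h = red_blocks h' -> ends_x h = ends_x h'.
Proof.
case: h h' => [|[[] [[i j] k]] h] [|[[] [[i' j'] k']] h'] //=;
  rewrite /expand_e; by do 2!case: (ends_x _).
Qed.

Lemma red_mono_mul ctx m m' n : red_mono ctx m = red_mono ctx m' ->
  red_mono ctx (mono_mul m n) = red_mono ctx (mono_mul m' n).
Proof.
case: m m' n => [[i j] k] [[i' j'] k'] [[i1 j1] k1].
rewrite /red_mono /expand_e.
case: ctx => /= -[z0 i0 iE jE]; last move=> kE.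
  rewrite (addnACA i) (addnACA j) (addnACA i') (addnACA j').
  rewrite (GRing.natrD _ (i + k)) (GRing.natrD _ (j + k)).
  rewrite (GRing.natrD _ (i' + k')) (GRing.natrD _ (j' + k')).
  by rewrite iE jE; congr (_, _, _, _, _); lia.
by rewrite !GRing.natrD iE jE kE; congr (_, _, _, _, _); lia.
Qed.

Lemma red_mono_block ctx m m' is_x : red_mono ctx m = red_mono ctx m' ->
  red_block ctx (is_x, m) = red_block ctx (is_x, m').
Proof.
rewrite /red_mono /red_block.
case: expand_e => [[i j] k]; case: expand_e => [[i' j'] k'].
by case=> _ -> -> -> ->.
Qed.

(** Serves a [b] passing through an [x]: the added [c] leaves the test [0 < i] unchanged and shifts
    [j], or [j - i], by one. *)
Lemma red_block_mulc ctx m m' :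
  red_block ctx (true, m) = red_block ctx (true, m') ->
  red_block ctx (true, mono_mul m (0, 1, 0)) =
  red_block ctx (true, mono_mul m' (0, 1, 0)).
Proof.
case: m m' => [[i j] k] [[i' j'] k']; rewrite /red_block /expand_e.
case: ctx => /=; rewrite !addn0.
  rewrite !(addnAC _ 1) !(GRing.natrD _ _ 1).
  case: ifP; case: ifP => // _ _ []; last by move=> -> ->.
  by rewrite ![(_ + 1%:R - _)%R]GRing.addrAC => ->.
by case: ifP; case: ifP => // _ _ []; rewrite !GRing.natrD => *; congruence.
Qed.

Arguments red_mono : simpl never.
Arguments red_block : simpl never.

Lemma red_state_step s s' g :
  red_state s = red_state s' -> red_state (step s g) = red_state (step s' g).
Proof.
case: s s' => h m [h' m'] [eq_h]; rewrite (red_blocks_ends_x eq_h) => eq_m.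
case: g; rewrite /red_state /=;
  rewrite ?eq_h ?(red_blocks_ends_x eq_h) ?(red_mono_mul _ eq_m) //; last first.
  by rewrite (red_mono_block _ eq_m).
(* The first flag of [red_mono] tells an empty monomial from one whose exponents vanish only in [V],
   so both parses treat [b] alike. *)
have m0 : (m == (0, 0, 0)) = (m' == (0, 0, 0)).
  move: eq_m; case: m m' => [[i j] k] [[i' j'] k'].
  by rewrite /red_mono /expand_e !xpair_eqE; case: ends_x => -[] *; lia.
rewrite m0; case: ifP => [/andP[h'x _]|_] /=; last first.
  by rewrite eq_h (red_blocks_ends_x eq_h) (red_mono_block _ eq_m).
case: h h' eq_h h'x {m0 eq_m} => [|[is_x n] h] [|[[] n'] h'] //= [eq_n eq_h] _.
have is_xT : is_x = true.
  by move: eq_n; rewrite /red_block; do 2!case: expand_e => [[? ?] ?]; case.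
rewrite is_xT (red_blocks_ends_x eq_h) in eq_n *.
by rewrite eq_h (red_block_mulc eq_n).
Qed.

(** The relation [xb = cx] is built into [step], the commutations into the exponents, [xca = xe]
    into [expand_e], and [aex = ax] into [red_block]. *)
Lemma red_state_relation u v s : (u, v) \in Q_relations ->
  red_state (foldl step s u) = red_state (foldl step s v).
Proof.
case: s => h [[i j] k]; rewrite !inE.
case/predU1P=> [[-> ->]|]; first by [].
case/predU1P=> [[-> ->]|]; first by rewrite /red_state /= !addn0.
case/predU1P=> [[-> ->]|]; first by rewrite /red_state /= !addn0.
case/predU1P=> [[-> ->]|]; first by rewrite /red_state /= !addn0.
case/predU1P=> [[-> ->]|/eqP[-> ->]]; first by rewrite /red_state /red_mono /=.
rewrite /red_state /= /red_block /=.
case: ends_x; rewrite !addn0 !addn1 //= !addnS !addSn /=.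
(* Between two [x], the [e] of [aex] raises both exponents by one and keeps their difference. *)
have -> : ((j + k).+1%:R - (i + k).+2%:R = (j + k)%:R - (i + k).+1%:R :> V)%R.
  rewrite -(GRing.natr1 _ (j + k)) -(GRing.natr1 _ (i + k).+1).
  by rewrite GRing.opprD GRing.addrACA GRing.subrr GRing.addr0.
by [].
Qed.

(** * Separating parses of bounded weight *)

Section Separation.
Variables (n : nat) (M : monoidType) (a b c e x : M).
Hypothesis V_inj : forall i j,
  i <= n.*2 -> j <= n.*2 -> i%:R%R = j%:R%R :> V -> i = j.
Local Open Scope group_scope.
Hypotheses (ac : commute a c) (ae : commute a e) (ec : commute e c).
Hypotheses (xca : x * c * a = x * e) (aex : a * e * x = a * x).

Let mval := mono_val a c e.
Let bval := blocks_val a b c e x.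

Lemma blocks_val_expand_e h m :
  bval h * mval m = bval h * mval (expand_e (ends_x h) m).
Proof.
have x_expand : x * mval m = x * mval (expand_e true m).
  by case: m => [[i j] k]; apply: x_mono_val.
case: m h x_expand => [[i j] k] [|[[] m'] h] // xm.
by rewrite /bval /= -mulgA xm mulgA.
Qed.

Lemma expand_e_le ctx m : let: (i, j, k) := expand_e ctx m in
  [/\ i <= mono_weight m, j <= mono_weight m & k <= mono_weight m].
Proof. by case: m => [[i j] k]; case: ctx => /=; split; lia. Qed.

(** The weight bound lets [V_inj] recover exponents from their images in [V]; what [red_block] drops
    is irrelevant by [mono_val_x] and [x_mono_val_x]. *)
Lemma blocks_val_red h h' :
  weight (h, (0, 0, 0)%N) <= n -> weight (h', (0, 0, 0)%N) <= n ->
  red_blocks h = red_blocks h' -> bval h = bval h'.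
Proof.
elim: h h' => [|[is_x m] h IH] [|[is_x' m'] h'] //.
rewrite /weight /= !big_cons /=.
move=> wh wh' [eq_m eq_h]; have eqv : bval h = bval h'.
  by apply: IH eq_h; rewrite /weight /=; lia.
have {}wm : mono_weight m <= n by lia.
have {}wm' : mono_weight m' <= n by lia.
rewrite /bval /= -/bval -/mval.
rewrite (blocks_val_expand_e h) (blocks_val_expand_e h') eqv.
move: eq_m; rewrite (red_blocks_ends_x eq_h) /red_block.
have expand_e_k ctx m1 : let: (i, j, k) := expand_e ctx m1 in ctx -> k = 0%N.
  by case: m1 => [[i1 j1] k1]; case: ctx.
move: (expand_e_k (ends_x h') m) (expand_e_k (ends_x h') m').
move: (expand_e_le (ends_x h') m) (expand_e_le (ends_x h') m').
case: (expand_e _ m) => [[i j] k] [le_i le_j le_k].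
case: (expand_e _ m') => [[i' j'] k'] [le_i' le_j' le_k'] k0 k0' [<-].
have same : i%:R%R = i'%:R%R :> V -> j%:R%R = j'%:R%R :> V ->
    k%:R%R = k'%:R%R :> V -> (i, j, k) = (i', j', k').
  by move=> ei ej ek; congr (_, _, _); apply: V_inj => //; lia.
case: is_x => /= [|[ei ej ek]]; last by rewrite same.
have ends_xP : ends_x h' -> exists d, bval h' = d * x.
  by case: h' {IH wh' eq_h eqv le_i le_j le_k le_i' le_j' le_k' k0 k0'} =>
    [|[[] m1] h1] // _; exists (bval h1 * mval m1).
move: ends_xP k0 k0'.
case: (ends_x h') => [/(_ isT)[d ->] /(_ isT) kE /(_ isT) kE'|_ _ _].
  case: ifP; case: ifP => // i'_gt0 i_gt0; last first.
    by case=> ei ej ek; rewrite same.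
  rewrite kE kE' -(prednK i_gt0) -(prednK i'_gt0) => -[/eqP].
  (* Equal differences become equal cross sums of exponents; each sum is at most [n.*2], whence the
     range required in [V_inj]. *)
  rewrite GRing.subr_eq GRing.addrAC eq_sym GRing.subr_eq -!GRing.natrD.
  move=> /eqP/V_inj eq_ij.
  rewrite -!(mulgA d); congr (d * _); apply: x_mono_val_x => //.
  by lia.
case: ifP; case: ifP => // i'_gt0 i_gt0; last by case=> ei ej ek; rewrite same.
case=> ei ej; rewrite -(prednK i_gt0) -(prednK i'_gt0).
rewrite -!(mulgA (bval h')) /mval.
rewrite (mono_val_x ac ae ec aex _ _ k) (mono_val_x ac ae ec aex _ _ k').
have -> : i = i' by apply: V_inj => //; lia.
by have -> : j = j' by apply: V_inj => //; lia.
Qed.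

Lemma state_val_red s s' : weight s <= n -> weight s' <= n ->
  red_state s = red_state s' ->
  state_val a b c e x s = state_val a b c e x s'.
Proof.
case: s s' => h m [h' m'] wm wm' [/= eq_h].
rewrite /state_val /= -/mval -/bval.
rewrite (blocks_val_expand_e h) (blocks_val_expand_e h').
have -> : bval h = bval h'.
  by apply: blocks_val_red eq_h; move: wm wm'; rewrite /weight /=; lia.
rewrite (red_blocks_ends_x eq_h) /red_mono.
move: (expand_e_le (ends_x h') m) (expand_e_le (ends_x h') m').
case: (expand_e _ m) => [[i j] k] [le_i le_j le_k].
case: (expand_e _ m') => [[i' j'] k'] [le_i' le_j' le_k'] [_ _ ei ej ek].
move: wm wm'; rewrite /weight /= => wm wm'.
have -> : i = i' by apply: V_inj => //; lia.
have -> : j = j' by apply: V_inj => //; lia.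
by have -> : k = k' by apply: V_inj => //; lia.
Qed.

End Separation.

End Reduction.

(** * Adjoining a unit *)

Section AdjoinUnit.
Local Open Scope group_scope.
Variable S : semigroupType.

(** Decoding takes place in a monoid, since an empty block list and zero exponents have value 1;
    [Some] embeds the semigroup into one. *)
Definition adjoin_unit := option S.

HB.instance Definition _ := Choice.on adjoin_unit.

Definition adjoin_unit_mul (p q : adjoin_unit) : adjoin_unit :=
  match p, q with
  | Some s, Some t => Some (s * t)
  | None, _ => q
  | _, None => p
  end.

Lemma adjoin_unit_mulA : associative adjoin_unit_mul.
Proof. by case=> [s|] [t|] [u|] //=; rewrite mulgA. Qed.

Lemma adjoin_unit_mul1s : left_id None adjoin_unit_mul.
Proof. by case. Qed.

Lemma adjoin_unit_muls1 : right_id None adjoin_unit_mul.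
Proof. by case. Qed.

HB.instance Definition _ := isMonoid.Build adjoin_unit
  adjoin_unit_mulA adjoin_unit_mul1s adjoin_unit_muls1.

End AdjoinUnit.

(** * The finite action on truncated parses *)

Section Truncation.
Variables (V : finNzRingType) (n : nat).

Definition trunc_state : finType :=
  option (n.-bseq (bool * (bool * V * V * V)) * (bool * bool * V * V * V)).

(* [None] is a sink for the parses with more than [n] blocks. *)
Definition trunc (s : state) : trunc_state :=
  omap (fun h => (h, (red_state V s).2)) (insub (red_state V s).1).

(** Makes the sink absorbing: a [b] that passes an [x] alters a block but removes none. *)
Lemma size_step s g : size s.1 <= size (step s g).1.
Proof.
by case: s => h m; case: g => //=; case: ifP => //= _; case: h => // -[].
Qed.

Lemma truncP s s' : trunc s = trunc s' <->
  red_state V s = red_state V s' \/ n < size s.1 /\ n < size s'.1.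
Proof.
rewrite /trunc; split=> [|[-> //|[]]]; last first.
  by do 2!(rewrite ltnNge => /negPf ?); rewrite !insubF //= size_red_blocks.
case: insubP => [h _ eq_h|]; case: insubP => [h' _ eq_h'|] //=.
  case=> eq_hh' eq_m; left; congr (_, _) => //.
  by rewrite -[LHS]eq_h -[RHS]eq_h' eq_hh'.
by rewrite !size_red_blocks -!ltnNge; right.
Qed.

Lemma trunc_step s s' g :
  trunc s = trunc s' -> trunc (step s g) = trunc (step s' g).
Proof.
move/truncP=> [/(red_state_step g) eq_s|[s_gt s'_gt]]; apply/truncP.
  by left.
by right; split; apply: leq_trans (size_step _ g).
Qed.

(** Acts through an arbitrary preimage, a choice made harmless by [trunc_step]. Points outside the
    image of [trunc] stay fixed, so the relations hold there trivially. *)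
Definition trunc_act (y : trunc_state) (g : generator) : trunc_state :=
  if pselect (exists s, trunc s = y) is left y_im
  then trunc (step (sval (cid y_im)) g) else y.

Lemma trunc_act_run s w : foldl trunc_act (trunc s) w = trunc (foldl step s w).
Proof.
elim: w s => //= g w IH s; rewrite -IH; congr foldl; rewrite /trunc_act.
case: pselect => [y_im|[]]; last by exists s.
by apply: trunc_step; case: cid.
Qed.

Lemma trunc_act_relation u v y : (u, v) \in Q_relations ->
  foldl trunc_act y u = foldl trunc_act y v.
Proof.
move=> Ruv; have [[s <-]|y_nim] := pselect (exists s, trunc s = y).
  by rewrite !trunc_act_run /trunc (red_state_relation _ _ Ruv).
have fix_y w : foldl trunc_act y w = y.
  by elim: w => //= g w IH; rewrite {2}/trunc_act; case: pselect.
by rewrite !fix_y.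
Qed.

End Truncation.

(** * Local embeddability of [Q] *)

Theorem proposition11 : LEF Q.
Proof.
(* The integers modulo [2n + 2]: a nonzero ring even for [n = 0], in which [0, ..., 2n] stay
   distinct. *)
apply: LEF_of_finite_actions => n; pose V : finNzRingType := 'I_(n.*2).+2.
have V_inj i j : i <= n.*2 -> j <= n.*2 -> i%:R%R = j%:R%R :> V -> i = j.
  by move=> le_i le_j /(congr1 val); rewrite /= !Zp_nat /= !modn_small //; lia.
pose s0 : state := ([::], (0, 0, 0)).
exists (trunc_state V n), (@trunc_act V n), (trunc V n s0).
split=> [u v y|u v le_u le_v]; first exact: trunc_act_relation.
pose piQ w : adjoin_unit Q := Some (\pi_(presented Q_relations) w).
pose q g := piQ (letter g).
have piQM w w' : (piQ w * piQ w')%g = piQ (w * w')%g.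
  by congr Some; apply: pi_presentedM.
have piQ_rel w w' : (w, w') \in Q_relations -> piQ w = piQ w'.
  by move=> Rw; congr Some; apply/presented_eqP/CongrRel.
have xb : (q gen_x * q gen_b = q gen_c * q gen_x)%g.
  by rewrite !piQM; apply: piQ_rel; rewrite !inE eqxx ?orbT.
have ac : commute (q gen_a) (q gen_c).
  by rewrite /commute !piQM; apply: piQ_rel; rewrite !inE eqxx ?orbT.
have ae : commute (q gen_a) (q gen_e).
  by rewrite /commute !piQM; apply: piQ_rel; rewrite !inE eqxx ?orbT.
have ec : commute (q gen_e) (q gen_c).
  by rewrite /commute !piQM; apply: piQ_rel; rewrite !inE eqxx ?orbT.
have xca : (q gen_x * q gen_c * q gen_a = q gen_x * q gen_e)%g.
  rewrite (piQM (letter gen_x) (letter gen_c)) !piQM.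
  by apply: piQ_rel; rewrite !inE eqxx ?orbT.
have aex : (q gen_a * q gen_e * q gen_x = q gen_a * q gen_x)%g.
  rewrite (piQM (letter gen_a) (letter gen_e)) !piQM.
  by apply: piQ_rel; rewrite !inE eqxx ?orbT.
pose val_st := state_val (q gen_a) (q gen_b) (q gen_c) (q gen_e) (q gen_x).
pose val_g := gen_val (q gen_a) (q gen_b) (q gen_c) (q gen_e) (q gen_x).
(* A nonempty prefix [w] is already read, since [piQ] is defined on nonempty words only. *)
have val_foldl (w w' : word generator) t : w' = w ++ t :> seq generator ->
    foldl (fun p g => p * val_g g)%g (piQ w) t = piQ w'.
  elim: t w => [|g t IH] w /= eq_w'.
    by congr piQ; apply: val_inj; rewrite /= eq_w' cats0.
  rewrite -(IH (w * letter g)%g) /= -?catA //; congr foldl.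
  by case: (g); apply: piQM.
have val_run (w : word generator) : val_st (foldl step s0 w) = piQ w.
  rewrite /val_st state_val_run //.
  case: w => -[//|g w] w0; rewrite -(val_foldl (letter g) (Word w0) w) //=.
  by congr foldl; rewrite /state_val /= /mono_val !mulg1 mul1g; case: (g).
have weight_n (w : word generator) :
    size w <= n -> weight (foldl step s0 w) <= n.
  by rewrite weight_run /weight big_nil.
(* Each block weighs at least one, so a word of at most [n] letters never reaches the sink. *)
have size_le s : size s.1 <= weight s.
  by rewrite /weight -sum1_size (leq_trans _ (leq_addr _ _)) ?leq_sum.
rewrite !trunc_act_run => /truncP[eq_red|[s_gt _]]; last first.
  have := leq_trans s_gt (leq_trans (size_le _) (weight_n _ le_u)).
  by rewrite ltnn.
suff [/presented_eqP] : piQ u = piQ v by [].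
rewrite -(val_run u) -(val_run v).
exact: (state_val_red _ V_inj ac ae ec xca aex (weight_n _ le_u)
          (weight_n _ le_v)).
Qed.
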